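(* Let $\mathcal{A}=V(Q)$ be an essential arrangement of lines in $\mathbb{P}^2$ with defining polynomial $Q\in\mathbb{C}[x,y,z]$. Suppose $\mathcal{A}$ is free and has a regular special logarithmic derivation of degree $d\geq 2$. Then $$\deg(\sqrt{J_Q})\leq d^2+d+1.$$
   Context: Let $R=\mathbb{C}[x,y,z]$. A line arrangement $\mathcal{A}$ in $\mathbb{P}^2$ (equivalently a central arrangement of planes in $\mathbb{C}^3$) is a finite set of distinct lines; its defining polynomial is $Q=L_1\cdots L_n$, the product of linear forms $L_i$ defining the lines. It is essential if the lines have no common point in $\mathbb{P}^2$. $J_Q=\langle Q_x,Q_y,Q_z\rangle$ is the Jacobian ideal, generated by the partial derivatives of $Q$. $\deg(\sqrt{J_Q})$ is the degree of the reduced zero-dimensional scheme in $\mathbb{P}^2$ defined by $\sqrt{J_Q}$, i.e. the number of points in the singular locus $V(J_Q)\subset\mathbb{P}^2$ (the number of points lying on at least two of the lines). $\mathcal{A}$ is free if the $R$-module $D(\mathcal{A})=\{\theta\in\mathrm{Der}_{\mathbb{C}}(R):\theta(Q)\in\langle Q\rangle R\}$ is free. A regular special logarithmic derivation of degree $d$ is a derivation $\theta=A\frac{\partial}{\partial x}+B\frac{\partial}{\partial y}+C\frac{\partial}{\partial z}$ with $A,B,C\in R$ homogeneous polynomials of the same degree $d$, such that $AQ_x+BQ_y+CQ_z=0$ and $\{A,B,C\}$ is an $R$-regular sequence. *)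

(* Defs.v *)
From HB Require Import structures.
From mathcomp Require Import all_boot all_order all_algebra.
From mathcomp Require Import complex.
From mathcomp Require Import boolp classical_sets functions cardinality reals.
From mathcomp Require Import finmap mpoly.

Set Implicit Arguments.
Unset Strict Implicit.
Unset Printing Implicit Defensive.

Import GRing.Theory.
Local Open Scope classical_set_scope.
Local Open Scope ring_scope.

Definition ideal_of (R : comNzRingType) (s : seq R) : set R :=
  [set f | exists c : 'I_(size s) -> R, f = \sum_(i < size s) c i * s`_i].

Definition radical (R : comNzRingType) (I : set R) : set R :=
  [set f | exists k : nat, I (f ^+ k)].

(* Each s_i is a nonzerodivisor modulo (s_0, ..., s_(i-1)), and the whole
   sequence does not generate the unit ideal. *)
Definition regular_sequence (R : comNzRingType) (s : seq R) : Prop :=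
  (forall i : 'I_(size s), forall f : R,
     ideal_of (take i s) (s`_i * f) -> ideal_of (take i s) f)
  /\ ~ ideal_of s 1.

Definition is_basis (R : nzRingType) (V : lmodType R) (M B : set V) : Prop :=
  [/\ B `<=` M,
      forall s : seq V, uniq s -> (forall v, v \in s -> B v) ->
        forall c : 'I_(size s) -> R,
          \sum_(i < size s) c i *: s`_i = 0 -> forall i, c i = 0
    & forall v, M v ->
        exists2 s : seq V, (forall w, w \in s -> B w)
          & exists c : 'I_(size s) -> R, v = \sum_(i < size s) c i *: s`_i].

(* Meant for a submodule M of V. *)
Definition free_module (R : nzRingType) (V : lmodType R) (M : set V) : Prop :=
  exists B : set V, is_basis M B.

(* The points of the projective plane are the lines through 0 in K^3. *)
Definition P2 (K : fieldType) : Type :=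
  {p : {vspace 'rV[K]_3} | \dim p == 1%N}.

HB.instance Definition _ (K : fieldType) := SubChoice.on (P2 K).

Definition vanishes_at (K : fieldType) (f : {mpoly K[3]}) (p : P2 K) : Prop :=
  forall v : 'rV[K]_3, v \in val p -> v != 0 -> f.@[v 0] = 0.

Definition proj_zeros (K : fieldType) (I : set {mpoly K[3]}) : set (P2 K) :=
  [set p | forall f, I f -> vanishes_at f p].

Definition line_of (K : fieldType) (l : {mpoly K[3]}) : set (P2 K) :=
  [set p | vanishes_at l p].

Record line_arrangement (K : fieldType) := LineArrangement {
  nlines : nat;
  form : 'I_nlines -> {mpoly K[3]};
  form_linear : forall i, form i \is 1.-homog;
  form_neq0 : forall i, form i != 0;
  lines_distinct : injective (fun i => line_of (form i))
}.

Definition defining_poly (K : fieldType) (A : line_arrangement K) :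
    {mpoly K[3]} :=
  \prod_(i < nlines A) form i.

Definition essential (K : fieldType) (A : line_arrangement K) : Prop :=
  ~ exists p : P2 K, forall i : 'I_(nlines A), line_of (form i) p.

Definition jacobian_ideal (K : fieldType) (Q : {mpoly K[3]}) :
    set {mpoly K[3]} :=
  ideal_of [seq Q^`M(i) | i <- enum 'I_3].

(* The degree of the reduced scheme defined by a radical homogeneous ideal I
   with finitely many projective zeros over an algebraically closed field, i.e.
   the number of these zeros.  fset_set is a junk value on infinite sets, so
   this is only meaningful together with finite_set (proj_zeros I). *)
Definition reduced_degree (K : fieldType) (I : set {mpoly K[3]}) : nat :=
  #|` fset_set (proj_zeros I)|.

(* Der_K(K[x,y,z]) is free on the partial derivatives, so the derivation
   A d/dx + B d/dy + C d/dz is encoded by the row vector (A, B, C). *)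
Notation derivation K := 'rV[{mpoly K[3]}]_3.

Definition der_apply (K : fieldType) (theta : derivation K)
    (f : {mpoly K[3]}) : {mpoly K[3]} :=
  \sum_(i < 3) theta 0 i * f^`M(i).

Definition log_derivations (K : fieldType) (A : line_arrangement K) :
    set (derivation K) :=
  [set theta | ideal_of [:: defining_poly A]
                        (der_apply theta (defining_poly A))].

Definition free_arrangement (K : fieldType) (A : line_arrangement K) : Prop :=
  free_module (log_derivations A).

Definition regular_special_log_derivation (K : fieldType)
    (A : line_arrangement K) (d : nat) (theta : derivation K) : Prop :=
  [/\ forall i, theta 0 i \is d.-homog,
      der_apply theta (defining_poly A) = 0
    & regular_sequence [seq theta 0 i | i <- enum 'I_3]].

(* Main.v *)
From HB Require Import structures.
Require Import Defs.
From mathcomp Require Import all_boot all_order all_algebra.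
From mathcomp Require Import complex.
From mathcomp Require Import boolp classical_sets functions cardinality reals.
From mathcomp Require Import finmap mpoly.
From mathcomp Require Import ring zify.

(** Let [x = (X, Y, Z)] be the Euler field and [theta = (A, B, C)] the given
    derivation.

    A singular point [p] of the arrangement lies on two distinct lines.  From
    [theta Q = 0] it follows that [theta] is tangent to every line of the
    arrangement, so that the vector [theta p] lies on the same two lines as [p]
    and is a multiple of [p].  Hence all singular points are zeros of the three
    2 x 2 minors of the matrix with rows [x] and [theta], that is, of the vector
    product [x × theta] ([singular_fixed]).

    It remains to show that at most [d ^ 2 + d + 1] points of the plane are
    zeros of the minors, i.e. fixed points of the self-map [A : B : C].  The
    syzygies of the minors are the combinations [a x + b theta]
    ([minor_syzygy]); this follows from the exactness of the Koszul complexes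
    of [x] and of [theta] alone, by an induction on degrees that works because
    [d >= 2].  Write [R_k] for the space of forms of degree [k], of dimension
    [binomial (k + 2) 2].  If [N] points are zeros of the minors, the sequence
      [R_(m-1) + R_(m-d) -> R_m ^ 3 -> R_(m+d+1) -> K ^ N],
    with maps [(a, b) |-> a x + b theta], [u |-> u . (x × theta)] and
    evaluation at the points, is a complex that is exact at [R_m ^ 3], and for [m] large
    the last map is onto by interpolation.  Comparing dimensions gives
      [N <= dim R_(m+d+1) - 3 dim R_m + dim R_(m-1) + dim R_(m-d)],
    and the right hand side is [d ^ 2 + d + 1] ([fixed_points_leq]).  As this
    bounds every finite set of singular points, it also shows that there are
    finitely many of them. *)

Set Implicit Arguments.
Unset Strict Implicit.
Unset Printing Implicit Defensive.

Import GRing.Theory Num.Theory.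
Local Open Scope classical_set_scope.
Local Open Scope ring_scope.

(** * Vector algebra in three coordinates *)

Section VectorAlgebra.
Variable R : comNzRingType.
Implicit Types u v w : 'rV[R]_3.

Definition dot u v : R := \sum_i u 0 i * v 0 i.

(** The usual vector product: index addition is cyclic, modulo 3. *)
Definition cross u v : 'rV[R]_3 :=
  \row_i (u 0 (i + 1) * v 0 (i + 2) - u 0 (i + 2) * v 0 (i + 1)).

Lemma ord3P (P : 'I_3 -> Prop) : P 0 -> P 1 -> P 2 -> forall i, P i.
Proof.
move=> P0 P1 P2 [[|[|[|//]]] lt_i3].
- by rewrite (_ : Ordinal _ = 0) //; apply: val_inj.
- by rewrite (_ : Ordinal _ = 1) //; apply: val_inj.
- by rewrite (_ : Ordinal _ = 2) //; apply: val_inj.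
Qed.

Lemma dotE u v : dot u v = u 0 0 * v 0 0 + u 0 1 * v 0 1 + u 0 2 * v 0 2.
Proof.
rewrite /dot 3!big_ord_recl big_ord0 addr0 addrA.
by congr (_ + _ * _ + _ * _); congr (_ 0 _); apply: val_inj.
Qed.

Lemma crossE u v :
  ((cross u v 0 0 = u 0 1 * v 0 2 - u 0 2 * v 0 1)
  * (cross u v 0 1 = u 0 2 * v 0 0 - u 0 0 * v 0 2)
  * (cross u v 0 2 = u 0 0 * v 0 1 - u 0 1 * v 0 0))%type.
Proof.
by do !split; rewrite mxE; congr (_ * _ - _ * _); congr (_ 0 _); apply: val_inj.
Qed.

Lemma rV3P u v :
  u 0 0 = v 0 0 -> u 0 1 = v 0 1 -> u 0 2 = v 0 2 -> u = v.
Proof. by move=> e0 e1 e2; apply/rowP; apply: ord3P. Qed.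

Lemma dot_crossA u v w : dot u (cross v w) = dot (cross u v) w.
Proof. by rewrite !dotE !crossE; ring. Qed.

Lemma dot_cross_self u v : dot u (cross u v) = 0.
Proof. by rewrite dotE !crossE; ring. Qed.

Lemma crossC u v : cross u v = - cross v u.
Proof. by apply: rV3P; rewrite [RHS]mxE !crossE; ring. Qed.

Lemma crossBl u v w : cross (u - v) w = cross u w - cross v w.
Proof. by apply: rV3P; rewrite !(crossE, mxE); ring. Qed.

Lemma crossZl a u v : cross (a *: u) v = a *: cross u v.
Proof. by apply: rV3P; rewrite !(crossE, mxE); ring. Qed.

Lemma dotC u v : dot u v = dot v u.
Proof. by apply: eq_bigr => i _; rewrite mulrC. Qed.

Lemma dotZl a u v : dot (a *: u) v = a * dot u v.
Proof. by rewrite !dotE !mxE; ring. Qed.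

Lemma cross_cross u v w : cross u (cross v w) = dot u w *: v - dot u v *: w.
Proof. by apply: rV3P; rewrite !(crossE, mxE, dotE); ring. Qed.

Lemma cross_eq0P u v : cross u v = 0 ->
  forall s t, u 0 s * v 0 t = u 0 t * v 0 s.
Proof.
move=> /rowP uv0; have := (uv0 0, uv0 1, uv0 2); rewrite !crossE !mxE.
case=> [[/subr0_eq e0 /subr0_eq e1] /subr0_eq e2].
by apply: ord3P; apply: ord3P.
Qed.

(** * The Koszul complex of a regular sequence of length three *)

Lemma ideal_of1 (a f : R) : ideal_of [:: a] f <-> exists g, f = g * a.
Proof.
split=> [[c ->]|[g ->]].
  by exists (c ord0); rewrite big_ord_recl big_ord0 addr0.
by exists (fun=> g); rewrite big_ord_recl big_ord0 addr0.
Qed.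

Lemma ideal_of2 (a b f : R) :
  ideal_of [:: a; b] f <-> exists g h, f = g * a + h * b.
Proof.
split=> [[c ->]|[g [h ->]]].
  exists (c 0), (c 1); rewrite !big_ord_recl big_ord0 addr0 /=.
  by congr (_ * _ + _ * _); congr (c _); apply: val_inj.
exists (fun i => if i == 0 then g else h).
by rewrite !big_ord_recl big_ord0 addr0.
Qed.

(** Write [v = (a, b, c)].  A relation [g0 a + g1 b + g2 c = 0] puts [g2] in
    [(a, b)] because [c] is regular modulo [(a, b)]; subtracting the
    corresponding trivial relations leaves a relation between [a] and [b], which
    is treated in the same way. *)
Lemma koszul_exact v g :
  regular_sequence [seq v 0 i | i <- enum 'I_3] -> dot g v = 0 ->
  exists w, g = cross v w.
Proof.
have -> : [seq v 0 i | i <- enum 'I_3] = [:: v 0 0; v 0 1; v 0 2].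
  rewrite enum_ordSl enum_ordSl enum_ordSl enum_ord0 /=.
  by congr [:: v 0 _; v 0 _; v 0 _]; apply: val_inj.
case=> reg _; rewrite dotE => g_v0.
have reg0 f : v 0 0 * f = 0 -> f = 0.
  move=> vf0; have [|c ->] := reg ord0 f; last by rewrite big_ord0.
  by exists (fun=> 0); rewrite vf0 big_ord0.
have /ideal_of2[a [b g2E]] : ideal_of [:: v 0 0; v 0 1] (g 0 2).
  apply: (reg (@Ordinal 3 2 isT)); apply/ideal_of2 => /=.
  exists (- g 0 0), (- g 0 1); apply: subr0_eq; rewrite -[RHS]g_v0.
  by ring.
have /ideal_of1[e g1E] : ideal_of [:: v 0 0] (g 0 1 + b * v 0 2).
  apply: (reg (@Ordinal 3 1 isT)); apply/ideal_of1 => /=.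
  exists (- (g 0 0 + a * v 0 2)); apply: subr0_eq; rewrite -[RHS]g_v0 g2E.
  by ring.
have g0E : g 0 0 + a * v 0 2 + e * v 0 1 = 0.
  apply: reg0; rewrite -[RHS]g_v0 g2E.
  rewrite [in RHS](_ : g 0 1 = e * v 0 0 - b * v 0 2); first by ring.
  by rewrite -g1E addrK.
(* Read off from the three relations as the solution of [g = cross v w]. *)
exists (\row_i [:: - b; a; - e]`_i); apply: rV3P; rewrite crossE !mxE /=.
- by apply: subr0_eq; rewrite -[RHS]g0E; ring.
- by apply: subr0_eq; rewrite -[RHS](subrr (e * v 0 0)) -{1}g1E; ring.
- by rewrite g2E; ring.
Qed.

End VectorAlgebra.

(** * Syzygies of the minors of the Euler field and a regular field *)

Section Homogeneous.
Variables (K : fieldType) (n : nat).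
Implicit Types p q : {mpoly K[n]}.

Lemma dhomogM_deg d e k p q :
  p \is d.-homog -> q \is e.-homog -> (d + e)%N = k -> p * q \is k.-homog.
Proof. by move=> p_hom q_hom <-; apply: dhomogM. Qed.

Lemma pihomogMl d p q k : p \is d.-homog ->
  pihomog mdeg k (p * q) =
    if (d <= k)%N then p * pihomog mdeg (k - d) q else 0.
Proof.
move=> p_hom; rewrite [q](@pihomog_partitionE _ _ mdeg _ _ (leqnn _)).
move: (msize q) => N; rewrite mulr_sumr !linear_sum /= mulr_sumr.
have term j : pihomog mdeg k (p * pihomog mdeg j q) =
    if (d <= k)%N then p * pihomog mdeg (k - d) (pihomog mdeg j q) else 0.
  have q_hom := pihomogP mdeg j q; have pq_hom := dhomogM p_hom q_hom.
  have [<-|kNdj] := eqVneq (d + j)%N k.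
    by rewrite leq_addr addKn (pihomog_dE pq_hom) (pihomog_dE q_hom).
  rewrite (pihomog_ne0 kNdj pq_hom); case: leqP => // le_dk.
  rewrite (pihomog_ne0 _ q_hom) ?mulr0 //.
  by apply: contra_neq kNdj => ->; rewrite subnKC.
rewrite (eq_bigr _ (fun (j : 'I_N) _ => term j)).
by case: leqP => // _; rewrite big1.
Qed.

Lemma mcoeffXM0 (i : 'I_n) p (m : 'X_{1..n}) : m i = 0%N -> ('X_i * p)@_m = 0.
Proof.
move=> mi0; rewrite -commr_mpolyX; apply/eqP; rewrite mcoeff_eq0.
rewrite (perm_mem (msuppMX p _)); apply/mapP => -[m' _ mE].
by move: mi0; rewrite mE mnmDE mnm1E eqxx.
Qed.

Lemma mpolyX_dvd (i j : 'I_n) p q :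
  i != j -> 'X_j * p = 'X_i * q -> exists r, p = 'X_i * r.
Proof.
move=> neq_ij eq_pq; exists (\sum_(m <- msupp p) p@_m *: 'X_[m - U_(i)]).
rewrite [LHS]mpolyE mulr_sumr; apply: eq_big_seq => m m_p.
rewrite -scalerAr -mpolyXD addmC submK // lep1mP; apply/eqP => mi0.
move: m_p; rewrite mcoeff_msupp -(mcoeffMX p U_(j)) commr_mpolyX eq_pq.
by rewrite mcoeffXM0 ?eqxx // mnmDE mnm1E mi0 eq_sym (negbTE neq_ij).
Qed.

End Homogeneous.

Section Syzygies.
Variable K : fieldType.
Implicit Types u v w theta : derivation K.

Definition euler : derivation K := \row_i 'X_i.

Definition homog_field d u := forall i, u 0 i \is d.-homog.

Lemma euler_homog : homog_field 1 euler.
Proof. by move=> i; rewrite mxE dhomogX; apply/eqP/mdeg1. Qed.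

Lemma cross_homog d e u v :
  homog_field d u -> homog_field e v -> homog_field (d + e) (cross u v).
Proof. by move=> hu hv i; rewrite mxE rpredB ?dhomogM. Qed.

(** From [X1 u0 = X0 u1] it follows that [X0] divides [u0]; the quotient is [b],
    and the other two coordinates follow by cancelling [X0]. *)
Lemma cross_euler_eq0 u : cross u euler = 0 -> exists b, u = b *: euler.
Proof.
move=> /rowP ue0.
have e1 := ue0 1; have e2 := ue0 2; rewrite !crossE !mxE in e1 e2.
have [b u0E] : exists b, u 0 0 = 'X_(0 : 'I_3) * b.
  apply: (@mpolyX_dvd _ _ 0 1 _ (u 0 1)) => //.
  by apply: subr0_eq; rewrite -[RHS]e2; ring.
have X0_inj p q : 'X_(0 : 'I_3) * p = 'X_0 * q :> {mpoly K[3]} -> p = q.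
  by apply: mulfI; rewrite -msupp_eq0 msuppX.
exists b; apply: rV3P; rewrite !mxE.
- by rewrite u0E mulrC.
- by apply: X0_inj; apply: subr0_eq; rewrite -[RHS]oppr0 -e2 u0E; ring.
- by apply: X0_inj; apply: subr0_eq; rewrite -[RHS]e1 u0E; ring.
Qed.

Let part k u : derivation K := \row_i pihomog mdeg k (u 0 i).

Lemma part_id k u : homog_field k u -> part k u = u.
Proof. by move=> hu; apply/rowP => i; rewrite mxE pihomog_dE. Qed.

Lemma part_homog k u : homog_field k (part k u).
Proof. by move=> i; rewrite mxE pihomogP. Qed.

Lemma part_cross d k theta w : homog_field d theta ->
  part k (cross theta w) =
    if (d <= k)%N then cross theta (part (k - d) w) else 0.
Proof.
move=> theta_hom; apply/rowP => i.
rewrite !mxE pihomogB !(pihomogMl _ _ (theta_hom _)).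
by case: leqP => _; rewrite !mxE // subrr.
Qed.

(** For a syzygy [u] of the minors, the field [u × euler] is orthogonal to
    [theta], hence equal to [theta × w] with [w] again a syzygy, of degree
    [deg u + 1 - d].  As [d >= 2] this is smaller than [deg u], so that
    [w = a euler + b theta] by induction and [(u - a theta) × euler = 0]. *)
Lemma minor_syzygy d theta :
  (2 <= d)%N -> homog_field d theta ->
  regular_sequence [seq theta 0 i | i <- enum 'I_3] ->
  forall k u, homog_field k u -> dot u (cross euler theta) = 0 ->
  exists a b, u = a *: euler + b *: theta.
Proof.
move=> d_ge2 theta_hom reg k; elim/ltn_ind: k => k IHk u u_hom u_syz.
have [w uE] := koszul_exact reg (etrans (esym (dot_crossA _ _ _)) u_syz).
have ue_hom : homog_field k.+1 (cross u euler).
  by rewrite -addn1; apply: cross_homog => //; apply: euler_homog.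
have := part_cross k.+1 w theta_hom; rewrite -uE part_id //.
case: leqP => [le_dk|_] {}uE; last first.
  by have [b ->] := cross_euler_eq0 uE; exists b, 0; rewrite scale0r addr0.
(* [u × euler] has degree [k + 1], so only the part of [w] of degree
   [k + 1 - d] contributes. *)
set w' := part _ w in uE.
have w'_syz : dot w' (cross euler theta) = 0.
  by rewrite dotC -dot_crossA -uE crossC dotC -scaleN1r dotZl dotC
             dot_cross_self mulr0.
have [||a [b w'E]] := IHk (k.+1 - d)%N _ w' _ w'_syz.
- lia.
- exact: part_homog.
have : cross (u - a *: theta) euler = 0.
  by rewrite crossBl crossZl uE w'E; apply: rV3P; rewrite !(crossE, mxE); ring.
case/cross_euler_eq0 => c uaE; exists c, a.
by rewrite -uaE subrK.
Qed.

(** Taking homogeneous parts of [a] and [b] does not change the combination when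
    [u] is homogeneous; this is the form used for counting dimensions. *)
Lemma minor_syzygy_homog d theta :
  (2 <= d)%N -> homog_field d theta ->
  regular_sequence [seq theta 0 i | i <- enum 'I_3] ->
  forall k u, (d <= k.+1)%N -> homog_field k.+1 u ->
  dot u (cross euler theta) = 0 ->
  exists a b, [/\ a \is k.-homog, b \is (k.+1 - d).-homog
                & u = a *: euler + b *: theta].
Proof.
move=> d_ge2 theta_hom reg k u le_dk u_hom u_syz.
have [a [b uE]] := minor_syzygy d_ge2 theta_hom reg u_hom u_syz.
exists (pihomog mdeg k a), (pihomog mdeg (k.+1 - d) b).
split; [exact: pihomogP | exact: pihomogP |].
apply/rowP => i; have := congr1 (fun v => part k.+1 v 0 i) uE.
rewrite /= part_id // => ->; rewrite !mxE pihomogD ![_ * 'X_i]mulrC.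
have X_hom := euler_homog i; rewrite mxE in X_hom.
rewrite (pihomogMl _ _ X_hom) subn1 /=.
by rewrite ![_ * theta 0 i]mulrC (pihomogMl _ _ (theta_hom i)) le_dk.
Qed.

End Syzygies.

(** * Counting points by linear algebra *)

Lemma hom_of_linear (K : fieldType) (U V : vectType K) (f : U -> V) :
  linear f -> exists F : 'Hom(U, V), F =1 f.
Proof.
move=> f_lin.
pose f' : {linear U -> V} := HB.pack f (GRing.isLinear.Build _ _ _ _ f f_lin).
by exists (linfun f') => u; apply: (lfunE f').
Qed.

(** In a complex [U -> V -> W -> T] that is exact at [V] and at [T], the kernel
    of [g] has dimension at most [dim U], and its image, being contained in the
    kernel of [h], has dimension at most [dim W - dim T]. *)
Lemma dim_complex_leq (K : fieldType) (U V W T : vectType K)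
    (f : U -> V) (g : V -> W) (h : W -> T) :
  linear f -> linear g -> linear h ->
  (forall v, g v = 0 -> exists u, v = f u) ->
  (forall v, h (g v) = 0) ->
  (forall t, exists w, t = h w) ->
  (dim T + dim V <= dim W + dim U)%N.
Proof.
move=> /hom_of_linear[F FE] /hom_of_linear[G GE] /hom_of_linear[H HE].
move=> ker_g hg0 h_surj.
have dimF := limg_ker_dim F fullv.
have dimG := limg_ker_dim G fullv.
have dimH := limg_ker_dim H fullv.
have kerG : (\dim (fullv :&: lker G) <= \dim (limg F))%N.
  apply/dimvS/subvP => v; rewrite memv_cap memvf memv_ker GE.
  by move=> /eqP/ker_g[u ->]; rewrite -FE memv_img ?memvf.
have imgG : (\dim (limg G) <= \dim (fullv :&: lker H))%N.
  apply/dimvS/subvP => _ /memv_imgP[v _ ->].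
  by rewrite memv_cap memvf memv_ker HE GE hg0 eqxx.
have imgH : limg H = fullv.
  apply/eqP; rewrite eqEsubv subvf; apply/subvP => t _.
  by have [w ->] := h_surj t; rewrite -HE memv_img ?memvf.
rewrite imgH in dimH; rewrite !dimvf in dimF dimG dimH kerG imgG *.
lia.
Qed.

Section Counting.
Variable K : fieldType.
Implicit Types (u v : derivation K) (p q : 'rV[K]_3).

Definition at_point p u : 'rV[K]_3 := map_mx (meval (p 0)) u.

Lemma at_cross p u v :
  at_point p (cross u v) = cross (at_point p u) (at_point p v).
Proof. by apply/rowP => i; rewrite !mxE mevalB !mevalM. Qed.

Lemma at_euler p : at_point p (euler K) = p.
Proof. by apply/rowP => i; rewrite !mxE mevalXU. Qed.

Lemma at_const p q : at_point p (map_mx (@mpolyC 3 K) q) = q.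
Proof. by apply/rowP => i; rewrite !mxE mevalC. Qed.

(** The coordinates of [euler × q] are linear forms vanishing at [q], one of
    which does not vanish at [p]. *)
Lemma separating_form p q : cross p q != 0 ->
  exists l : {mpoly K[3]}, [/\ l \is 1.-homog, l.@[p 0] != 0 & l.@[q 0] = 0].
Proof.
move=> /rV0Pn[t pq_t]; pose u := cross (euler K) (map_mx (@mpolyC 3 K) q).
have ev (r : 'rV[K]_3) : (u 0 t).@[r 0] = cross r q 0 t.
  by rewrite -[LHS]/(meval (r 0) _) -(at_euler r) -[in RHS](at_const r q)
             -at_cross [RHS]mxE at_euler.
exists (u 0 t); split; [|by rewrite ev|by rewrite ev mxE mulrC subrr].
apply: (@cross_homog _ 1 0); first exact: euler_homog.
by move=> i; rewrite mxE -[_%:MP]mulr1 mul_mpolyC rpredZ ?dhomog1.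
Qed.

Lemma nonvanishing_form p : p != 0 ->
  exists l : {mpoly K[3]}, l \is 1.-homog /\ l.@[p 0] != 0.
Proof.
move=> /rV0Pn[t pt]; exists 'X_t; rewrite mevalXU; split => //.
by rewrite dhomogX; apply/eqP/mdeg1.
Qed.

(** Lagrange interpolation: a product of [N - 1] linear forms, each vanishing at
    one of the other points, isolates a given point. *)
Lemma interpolation N k (s : 'I_N -> 'rV[K]_3) : (N <= k.+1)%N ->
  (forall i, s i != 0) -> (forall i j, i != j -> cross (s i) (s j) != 0) ->
  forall c : 'I_N -> K,
  exists2 f : {mpoly K[3]}, f \is k.-homog & forall i, f.@[s i 0] = c i.
Proof.
move=> le_N_k s_neq0 s_neq c.
have /choice[l lP] (ij : 'I_N * 'I_N) : exists l : {mpoly K[3]},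
    ij.1 != ij.2 ->
    [/\ l \is 1.-homog, l.@[s ij.1 0] != 0 & l.@[s ij.2 0] = 0].
  have [_|/s_neq/separating_form[l lP]] := eqVneq ij.1 ij.2; first by exists 0.
  by exists l.
have /choice[m mP] i := nonvanishing_form (s_neq0 i).
(* The power of [m i] brings the product of [N - 1] forms to degree [k]. *)
pose f i := m i ^+ (k.+1 - N) * \prod_(j | j != i) l (i, j).
have f_hom i : f i \is k.-homog.
  have -> : k = (1 * (k.+1 - N) + (N - 1))%N.
    by have := ltn_ord i; rewrite mul1n; lia.
  apply: dhomogM; first by apply: dhomogMn; have [] := mP i.
  have -> : (N - 1)%N = (\sum_(j < N | j != i) 1)%N.
    by rewrite sum1_card cardC1 card_ord subn1.
  apply: (big_ind2 (fun (p : {mpoly K[3]}) (e : nat) => p \is e.-homog)).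
  - exact: dhomog1.
  - by move=> *; apply: dhomogM.
  - by move=> j ji; have [] := lP (i, j); rewrite /= eq_sym.
have f_ne i : (f i).@[s i 0] != 0.
  rewrite mevalM rmorphXn rmorph_prod mulf_neq0 //.
    by rewrite expf_neq0 //; have [] := mP i.
  apply/prodf_neq0 => j ji; have [] := lP (i, j) => //=.
  by rewrite eq_sym.
have f_eq0 i j : i != j -> (f i).@[s j 0] = 0.
  move=> ij; rewrite mevalM rmorph_prod (bigD1 j) 1?eq_sym //=.
  by have [_ _ ->] := lP (i, j) ij; rewrite mul0r mulr0.
exists (\sum_i (c i / (f i).@[s i 0]) *: f i).
  by apply: rpred_sum => i _; apply: rpredZ; apply: f_hom.
move=> i; rewrite raddf_sum (bigD1 i) //= mevalZ divfK // big1 ?addr0 //.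
by move=> j ji; rewrite mevalZ (f_eq0 j i) ?mulr0.
Qed.

Lemma bin_form k : (2 * 'C(k + 2, k) = (k + 2) * (k + 1))%N.
Proof.
rewrite -{2}(addnK 2 k) bin_sub ?leq_addl //.
have := bin_ffact (k + 2) 2; rewrite addn2 addn1 !ffactnS ffactn0 muln1.
by rewrite mulnC.
Qed.

(** The fixed points [s i] of the self-map [theta] of the plane impose
    independent conditions on forms of large degree [k], and every form of
    degree [k] in the ideal of the minors satisfies these conditions.  Since the
    syzygies of the minors are known, the forms of degree [k] in that ideal have
    codimension at most [d ^ 2 + d + 1]. *)
Lemma fixed_points_leq d N (theta : derivation K) (s : 'I_N -> 'rV[K]_3) :
  (2 <= d)%N -> homog_field d theta ->
  regular_sequence [seq theta 0 i | i <- enum 'I_3] ->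
  (forall i, s i != 0) -> (forall i j, i != j -> cross (s i) (s j) != 0) ->
  (forall i, cross (s i) (at_point (s i) theta) = 0) ->
  (N <= d ^ 2 + d + 1)%N.
Proof.
move=> d_ge2 theta_hom reg s_neq0 s_neq s_fix.
(* The syzygies are taken in degree [m + 1].  This [m] makes [k] large enough for
   interpolation at [N] points and [m + 1 - d] a nonnegative degree. *)
pose m := (N + d)%N; pose k := (m.+1 + (1 + d))%N.
pose M := cross (euler K) theta.
have M_hom : homog_field (1 + d) M := cross_homog (@euler_homog K) theta_hom.
pose U : vectType K := (dhomog 3 K m * dhomog 3 K (m.+1 - d))%type.
pose V : vectType K := {ffun 'I_3 -> dhomog 3 K m.+1}.
pose W : vectType K := dhomog 3 K k.
pose fpol (x : U) i : {mpoly K[3]} :=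
  val x.1 * euler K 0 i + val x.2 * theta 0 i.
have fpol_hom x i : fpol x i \is m.+1.-homog.
  apply: rpredD.
    apply: dhomogM_deg (dhomog_is_dhomog x.1) (euler_homog K i) _.
    by rewrite addn1.
  apply: dhomogM_deg (dhomog_is_dhomog x.2) (theta_hom i) _.
  by rewrite subnK // /m; lia.
pose f (x : U) : V := [ffun i => DHomog (fpol_hom x i)].
pose gpol (y : V) : {mpoly K[3]} := \sum_i val (y i) * M 0 i.
have gpol_hom y : gpol y \is k.-homog.
  by apply: rpred_sum => i _; apply: dhomogM; rewrite ?dhomog_is_dhomog.
pose g (y : V) : W := DHomog (gpol_hom y).
pose h (z : W) : 'rV[K]_N := \row_i (val z).@[s i 0].
have f_lin : linear f.
  move=> a x y; apply/ffunP => i; rewrite !ffunE; apply: val_inj => /=.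
  rewrite /fpol -[(a *: x + y).1]/(a *: x.1 + y.1).
  rewrite -[(a *: x + y).2]/(a *: x.2 + y.2) !linearP /=.
  by rewrite !mulrDl -!scalerAl scalerDr addrACA.
have g_lin : linear g.
  move=> a x y; apply: val_inj => /=; rewrite /gpol scaler_sumr -big_split /=.
  by apply: eq_bigr => i _; rewrite !ffunE /= mulrDl scalerAl.
have h_lin : linear h.
  by move=> a x y; apply/rowP => i; rewrite !mxE /= linearP.
have ker_g y : g y = 0 -> exists x, y = f x.
  move=> /(congr1 val) /= gy0.
  have [|||a [b [a_hom b_hom yE]]] := @minor_syzygy_homog K d theta d_ge2
      theta_hom reg m (\row_i val (y i)).
  - by rewrite /m; lia.
  - by move=> i; rewrite mxE; apply: dhomog_is_dhomog.
  - by rewrite -[RHS]gy0; apply: eq_bigr => i _; rewrite mxE.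
  exists (DHomog a_hom, DHomog b_hom); apply/ffunP => i; rewrite ffunE.
  apply: val_inj; rewrite /= /fpol /=.
  by have /rowP/(_ i) := yE; rewrite !mxE.
have hg0 y : h (g y) = 0.
  apply/rowP => i; rewrite !mxE /= raddf_sum big1 // => j _.
  have /rowP/(_ j) := s_fix i; rewrite -{1}(at_euler (s i)) -at_cross.
  by rewrite !mxE /= mevalM => ->; rewrite mulr0.
have h_surj t : exists z, t = h z.
  have [|p p_hom pE] := @interpolation N k s _ s_neq0 s_neq (t 0).
    by rewrite /k /m; lia.
  by exists (DHomog p_hom); apply/rowP => i; rewrite mxE pE.
have := dim_complex_leq f_lin g_lin h_lin ker_g hg0 h_surj.
rewrite -[dim 'rV_N]/(1 * N)%N -[dim V]/(#|'I_3| * 'C(m.+1 + 2, m.+1))%N.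
rewrite -[dim W]/'C(k + 2, k).
rewrite -[dim U]/('C(m + 2, m) + 'C(m.+1 - d + 2, m.+1 - d))%N card_ord.
have := (bin_form m.+1, bin_form k, bin_form m, bin_form (m.+1 - d)).
have -> : (m.+1 - d = N.+1)%N by rewrite /m; lia.
rewrite /k /m expnS expn1 => -[[[e1 e2] e3] e4] le; lia.
Qed.

End Counting.

(** * Linear forms and tangency *)

Lemma cross_eq0_scale (K : fieldType) (u v : 'rV[K]_3) :
  cross u v = 0 -> v != 0 -> exists c, u = c *: v.
Proof.
move=> uv0 /rV0Pn[t vt]; exists (u 0 t / v 0 t); apply/rowP => s.
by rewrite mxE mulrAC -(cross_eq0P uv0) mulfK.
Qed.

Section LinearForms.
Variable K : fieldType.
Implicit Types (l f g : {mpoly K[3]}) (theta : derivation K) (v : 'rV[K]_3).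

Definition coefs l : 'rV[K]_3 := \row_i l@_U_(i).

Lemma linear_formE l : l \is 1.-homog -> l = \sum_i coefs l 0 i *: 'X_i.
Proof.
move=> l_hom; apply/mpolyP => m; rewrite linear_sum /=.
have [/eqP/mdeg1P[j /eqP ->]|m_neq1] := eqVneq (mdeg m) 1%N.
  rewrite (bigD1 j) //= big1 => [|i ij].
    by rewrite mcoeffZ mcoeffX eqxx mulr1 addr0 mxE.
  rewrite mcoeffZ mcoeffX; case: eqP => [/mnmP/(_ j)|_]; last by rewrite mulr0.
  by rewrite !mnm1E eqxx (negbTE ij).
rewrite (dhomog_nemf_coeff l_hom m_neq1) big1 // => i _.
rewrite mcoeffZ mcoeffX; case: eqP => [mE|_]; last by rewrite mulr0.
by rewrite -mE mdeg1 in m_neq1.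
Qed.

Lemma linear_form_meval l v : l \is 1.-homog -> l.@[v 0] = dot (coefs l) v.
Proof.
move=> /linear_formE {1}->; rewrite raddf_sum; apply: eq_bigr => i _ /=.
by rewrite mevalZ mevalXU.
Qed.

Lemma linear_form_mderiv l i : l \is 1.-homog -> l^`M(i) = (coefs l 0 i)%:MP.
Proof.
move=> /linear_formE {1}->; rewrite linear_sum (bigD1 i) //= big1 => [|j ji].
  rewrite mderivZ mderivX mnm1E eqxx addr0 mulr1n scale1r -mul_mpolyC.
  by rewrite (_ : U_(i) - U_(i) = 0)%MM ?mpolyX0 ?mulr1 //; apply/mnmP => k;
     rewrite mnmBE subnn mnm0E.
by rewrite mderivZ mderivX mnm1E (negbTE ji) mulr0n scale0r scaler0.
Qed.

Lemma coefs_neq0 l : l \is 1.-homog -> l != 0 -> coefs l != 0.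
Proof.
move=> l_hom; apply: contra_neq => l0; rewrite (linear_formE l_hom) l0.
by rewrite big1 // => i _; rewrite mxE scale0r.
Qed.

Lemma der_applyM theta f g :
  der_apply theta (f * g) = der_apply theta f * g + f * der_apply theta g.
Proof.
rewrite /der_apply mulr_suml mulr_sumr -big_split; apply: eq_bigr => i _ /=.
by rewrite mderivM; ring.
Qed.

Lemma der_apply_linear_form theta l v : l \is 1.-homog ->
  (der_apply theta l).@[v 0] = dot (coefs l) (at_point v theta).
Proof.
move=> l_hom; rewrite raddf_sum; apply: eq_bigr => i _ /=.
by rewrite linear_form_mderiv // mevalM mevalC !mxE mulrC.
Qed.

Lemma euler_prod n (L : 'I_n -> {mpoly K[3]}) : (forall i, L i \is 1.-homog) ->
  der_apply (euler K) (\prod_i L i) = n%:R * \prod_i L i.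
Proof.
move=> L_hom; have -> : n%:R = (\sum_(i < n) 1)%:R :> {mpoly K[3]}.
  by rewrite sum1_card card_ord.
apply: (big_ind2 (fun (f : {mpoly K[3]}) e => der_apply (euler K) f = e%:R * f)).
- by rewrite mul0r /der_apply big1 // => i _; rewrite -mpolyC1 mderivC mulr0.
- by move=> f a g b fE gE; rewrite der_applyM fE gE natrD; ring.
- move=> i _; rewrite mul1r [RHS](linear_formE (L_hom i)); apply: eq_bigr => j _.
  by rewrite linear_form_mderiv // !mxE -mul_mpolyC mulrC.
Qed.

(** The projection of the space onto the plane [l = 0] along [c], when
    [l c = 1], acting on polynomials by substitution. *)
Definition plane_proj l (c : 'rV[K]_3) : 3.-tuple {mpoly K[3]} :=
  [tuple 'X_i - c 0 i *: l | i < 3].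

Lemma plane_proj_form l c f : f \is 1.-homog ->
  f \mPo plane_proj l c = f - f.@[c 0] *: l.
Proof.
move=> f_hom; rewrite linear_form_meval // [in LHS](linear_formE f_hom).
rewrite [X in _ = X - _](linear_formE f_hom) linear_sum scaler_suml -sumrB.
apply: eq_bigr => i _ /=; rewrite linearZ /= comp_mpolyXU -tnth_nth tnth_mktuple.
by rewrite scalerBr scalerA.
Qed.

Lemma plane_proj_id l c f v : l.@[v 0] = 0 ->
  (f \mPo plane_proj l c).@[v 0] = f.@[v 0].
Proof.
move=> lv0; rewrite comp_mpoly_meval; apply: meval_eq => i.
by rewrite tnth_mktuple mevalB mevalZ mevalXU lv0 mulr0 subr0.
Qed.

(** On the plane [l = 0] the Leibniz rule leaves [theta l * prod L = 0].  The
    functions on the plane form an integral domain, and none of the [L i]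
    vanishes identically there, as none is a multiple of [l]; so [theta l] does,
    which means that [theta] is tangent to the plane. *)
Lemma tangent_to_factor theta l (I : finType) (P : pred I)
    (L : I -> {mpoly K[3]}) :
  l \is 1.-homog -> l != 0 -> (forall i, L i \is 1.-homog) ->
  (forall i, P i -> forall a, L i != a *: l) ->
  der_apply theta (l * \prod_(i | P i) L i) = 0 ->
  forall v, l.@[v 0] = 0 -> (der_apply theta l).@[v 0] = 0.
Proof.
move=> l_hom l_neq0 L_hom L_l theta0 v lv0.
have /rV0Pn[t lt] := coefs_neq0 l_hom l_neq0.
pose c : 'rV[K]_3 := (coefs l 0 t)^-1 *: delta_mx 0 t.
have lc1 : l.@[c 0] = 1.
  rewrite linear_form_meval // /dot (bigD1 t) //= big1 => [|i it].
    have -> : c 0 t = (coefs l 0 t)^-1 by rewrite !mxE !eqxx mulr1.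
    by rewrite divff ?addr0.
  by rewrite !mxE (negbTE it) andbF !mulr0.
(* Substituting the projection amounts to restricting to the plane [l = 0]. *)
have := congr1 (fun f => f \mPo plane_proj l c) theta0.
rewrite der_applyM rmorphD !rmorphM rmorph0 /=.
rewrite (plane_proj_form _ _ l_hom) lc1 scale1r subrr mul0r addr0.
move=> /eqP; rewrite mulf_eq0 => /orP[/eqP l0|].
  by rewrite -(plane_proj_id c _ lv0) l0 meval0.
rewrite rmorph_prod => /prodf_eq0[i Pi] /=.
rewrite plane_proj_form // subr_eq0 => /eqP LiE.
by have := L_l i Pi (L i).@[c 0]; rewrite -LiE eqxx.
Qed.

(** The coefficient vectors of [l] and [f] are orthogonal to [p] and to [q].  If
    [p × q] were nonzero, both would be multiples of it, and [f] a multiple of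
    [l]. *)
Lemma cross_eq0_forms l f (p q : 'rV[K]_3) : l \is 1.-homog -> f \is 1.-homog ->
  l != 0 -> (forall a, f != a *: l) ->
  l.@[p 0] = 0 -> f.@[p 0] = 0 -> l.@[q 0] = 0 -> f.@[q 0] = 0 ->
  cross p q = 0.
Proof.
move=> l_hom f_hom l_neq0 f_l; rewrite !linear_form_meval // => lp fp lq fq.
have orth u : dot u p = 0 -> dot u q = 0 -> cross u (cross p q) = 0.
  by move=> up uq; rewrite cross_cross up uq !scale0r subrr.
apply/eqP/negP => /negP pq_neq0.
have [a lE] := cross_eq0_scale (orth _ lp lq) pq_neq0.
have [b fE] := cross_eq0_scale (orth _ fp fq) pq_neq0.
have a_neq0 : a != 0.
  by apply: contra_neq (coefs_neq0 l_hom l_neq0) => a0; rewrite lE a0 scale0r.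
suff fE' : f = (b / a) *: l by have := f_l (b / a); rewrite -fE' eqxx.
rewrite [in LHS](linear_formE f_hom) [in RHS](linear_formE l_hom) scaler_sumr.
apply: eq_bigr => i _.
by rewrite fE lE !(mxE _ _ 0 i) scalerA mulrA divfK.
Qed.

End LinearForms.

(** * Singular points are fixed points *)

Section SingularPoints.
Variables (K : fieldType) (A : line_arrangement K).
Hypothesis charK : [pchar K] =i pred0.
Local Notation L := (@Defs.form K A).
Local Notation Q := (defining_poly A).

Lemma forms_not_proportional (i j : 'I_(nlines A)) : i != j ->
  forall a, L j != a *: L i.
Proof.
move=> neq_ij a; apply: contra_neq neq_ij => LjE.
have a_neq0 : a != 0.
  by apply: contra_neq (form_neq0 j) => a0; rewrite LjE a0 scale0r.
apply: (@lines_distinct K A); apply/seteqP; split => p /= vanish v vp v0;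
  have := vanish v vp v0; rewrite LjE mevalZ.
- by move=> ->; rewrite mulr0.
- by move/eqP; rewrite mulf_eq0 (negbTE a_neq0) => /eqP.
Qed.

Lemma defining_polyD1 i : Q = L i * \prod_(j | j != i) L j.
Proof. by rewrite /defining_poly (bigD1 i). Qed.

(** Euler's formula puts a singular point on some line, the gradient of a
    product on a second one. *)
Lemma singular_on_two_lines (p : 'rV[K]_3) : (0 < nlines A)%N ->
  (forall t, (Q^`M(t)).@[p 0] = 0) ->
  exists i j, [/\ i != j, (L i).@[p 0] = 0 & (L j).@[p 0] = 0].
Proof.
move=> n_gt0 dQ0; have L_hom := @form_linear K A.
have /eqP : (der_apply (euler K) Q).@[p 0] = 0.
  by rewrite raddf_sum big1 // => t _ /=; rewrite mevalM dQ0 mulr0.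
rewrite euler_prod // mevalM rmorph_nat mulf_eq0.
rewrite (pcharf0P _).1 // gtn_eqF //= => Q0.
have [i _ /eqP Li0] : exists2 i, true & (L i).@[p 0] == 0.
  by apply/prodf_eq0; rewrite rmorph_prod in Q0.
have /rV0Pn[t Lit] := coefs_neq0 (L_hom i) (form_neq0 i).
have := dQ0 t; rewrite (defining_polyD1 i) mderivM mevalD !mevalM Li0 mul0r addr0.
rewrite linear_form_mderiv // mevalC => /eqP.
rewrite mulf_eq0 (negbTE Lit) rmorph_prod => /prodf_eq0[j ji /eqP Lj0].
by exists i, j; rewrite eq_sym.
Qed.

(** Both lines through [p] also contain [theta p], which is thus a multiple of
    [p]. *)
Lemma singular_fixed theta (p : 'rV[K]_3) : (0 < nlines A)%N ->
  der_apply theta Q = 0 -> (forall t, (Q^`M(t)).@[p 0] = 0) ->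
  cross p (at_point p theta) = 0.
Proof.
move=> n_gt0 theta0 /(singular_on_two_lines n_gt0)[i [j [neq_ij Li0 Lj0]]].
have L_hom := @form_linear K A.
have tangent h : (L h).@[p 0] = 0 -> (L h).@[at_point p theta 0] = 0.
  move=> Lh0; rewrite linear_form_meval // -der_apply_linear_form //.
  apply: (@tangent_to_factor _ _ _ _ (fun g => g != h) L) Lh0 => //.
  - exact: form_neq0.
  - by move=> g gh a; apply: forms_not_proportional; rewrite eq_sym.
  - by rewrite -defining_polyD1.
apply: (cross_eq0_forms (L_hom i) (L_hom j)) => //.
- exact: form_neq0.
- exact: forms_not_proportional.
- exact: tangent.
- exact: tangent.
Qed.

End SingularPoints.

(** * The projective bound *)

Section Projective.
Context {K : fieldType}.

Definition coords (p : P2 K) : 'rV[K]_3 := vpick (val p).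

Lemma coords_neq0 p : coords p != 0.
Proof. by rewrite vpick0 -dimv_eq0 (eqP (valP p)). Qed.

Lemma coords_span p : val p = <[coords p]>%VS.
Proof.
apply/esym/eqP; rewrite eqEdim -memvE memv_pick (eqP (valP p)).
by rewrite dim_vline coords_neq0.
Qed.

Lemma cross_coords_neq0 p q : p != q -> cross (coords p) (coords q) != 0.
Proof.
apply: contra_neq => pq0; apply: val_inj.
have [c pE] := cross_eq0_scale pq0 (coords_neq0 q).
have := coords_neq0 p; rewrite pE scaler_eq0 negb_or => /andP[c0 _].
apply/eqP; rewrite eqEdim (eqP (valP p)) (eqP (valP q)) leqnn andbT.
by rewrite coords_span pE -memvE memvZ ?memv_pick.
Qed.

Lemma mem_ideal_of (R : comNzRingType) (s : seq R) x : x \in s -> ideal_of s x.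
Proof.
move=> xs; have lt_xs : (index x s < size s)%N by rewrite index_mem.
exists (fun i => (i == Ordinal lt_xs)%:R).
rewrite (bigD1 (Ordinal lt_xs)) //= eqxx mul1r nth_index // big1 ?addr0 //.
by move=> i /negbTE->; rewrite mul0r.
Qed.

Lemma singular_mderiv (Q : {mpoly K[3]}) p :
  proj_zeros (radical (jacobian_ideal Q)) p ->
  forall t, (Q^`M(t)).@[coords p 0] = 0.
Proof.
move=> sing t; apply: sing; rewrite ?memv_pick ?coords_neq0 //.
exists 1%N; rewrite expr1; apply: mem_ideal_of.
by apply/mapP; exists t; rewrite ?mem_enum.
Qed.

(** An infinite set has finite subsets of every size. *)
Lemma finite_set_of_bound (T : choiceType) (X : set T) n :
  (forall B : {fset T}, [set` B] `<=` X -> (#|` B| <= n)%N) ->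
  finite_set X /\ (#|` fset_set X| <= n)%N.
Proof.
move=> bound; suff fX : finite_set X.
  by split=> //; apply: bound; rewrite fset_setK.
apply: contrapT => /(@infinite_set_fset _ _ n.+1)[B /bound].
by rewrite leqNgt => /negP.
Qed.

End Projective.

Theorem proposition3p1 (R : realType) (A : line_arrangement R[i]) (d : nat) :
  essential A ->
  free_arrangement A ->
  (2 <= d)%N ->
  (exists theta : derivation R[i], regular_special_log_derivation A d theta) ->
  finite_set (proj_zeros (radical (jacobian_ideal (defining_poly A)))) /\
  (reduced_degree (radical (jacobian_ideal (defining_poly A)))
     <= d ^ 2 + d + 1)%N.
Proof.
move=> ess _ d_ge2 [theta [theta_hom theta0 reg]].
apply: finite_set_of_bound => B B_sing.
pose s (k : 'I_#|` B|) := tnth (in_tuple (enum_fset B)) k.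
have s_sing k : proj_zeros (radical (jacobian_ideal (defining_poly A))) (s k).
  by apply: B_sing; apply: mem_tnth.
(* The empty arrangement is excluded: any point would be on all its lines. *)
have n_gt0 (p : P2 R[i]) : (0 < nlines A)%N.
  rewrite lt0n; apply/eqP => n0; apply: ess; exists p => k.
  by have := leq_trans (ltn_ord k) (eq_leq n0).
apply: (@fixed_points_leq _ d _ theta (fun k => coords (s k))) => //=
  [k|k1 k2 neq_k|k].
- exact: coords_neq0.
- apply: cross_coords_neq0; apply: contra_neq neq_k => /tuple_uniqP.
  by apply; apply: fset_uniq.
- apply: (@singular_fixed _ A) => //; [exact: pchar_num | exact: n_gt0 (s k) |].
  exact: singular_mderiv.
Qed.
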